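(* Let $F=G+H$ be as in the context, where each $h_j:\mathbb{R}^n\to\mathbb{R}$ is continuously differentiable, each $g_j:\mathbb{R}^n\to\mathbb{R}\cup\{+\infty\}$ is proper, convex and lower semicontinuous, and $\mathrm{dom}(G)$ is convex and compact. Let $(x^k)_{k\in\mathbb{N}}$ be an infinite sequence generated by the generalized conditional gradient method with Armijo step sizes (so that $\theta(x^k)<0$ for all $k$). Then every limit point $\bar x$ of $(x^k)_{k\in\mathbb{N}}$ is a Pareto critical point of the problem $\min_{x\in\mathbb{R}^n}F(x)$.
   Context: $\mathcal{J}=\{1,\dots,m\}$, $\mathbb{N}=\{0,1,2,\dots\}$, $e=(1,\dots,1)^T\in\mathbb{R}^m$, and $u\preceq v$ in $\mathbb{R}^m$ means $v-u\in\mathbb{R}^m_+$. $F=(f_1,\dots,f_m)$, $f_j=g_j+h_j$, $G=(g_1,\dots,g_m)$, $H=(h_1,\dots,h_m)$, $\mathrm{dom}(G)=\{x\in\mathbb{R}^n: g_j(x)<+\infty\text{ for all }j\in\mathcal{J}\}$. A point $\bar x\in\mathrm{dom}(G)$ is Pareto critical if $\max_{j\in\mathcal{J}}f_j'(\bar x;d)\ge0$ for all $d\in\mathbb{R}^n$, where $f_j'(x;d)=\lim_{\alpha\to0^+}(f_j(x+\alpha d)-f_j(x))/\alpha$ (in the extended reals). For $x\in\mathrm{dom}(G)$, $\theta(x):=\min_{u\in\mathbb{R}^n}\max_{j\in\mathcal{J}}\big(g_j(u)-g_j(x)+\langle\nabla h_j(x),u-x\rangle\big)\le 0$, and $p(x)\in\mathrm{dom}(G)$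 denotes a point $u$ attaining this minimum. Generalized conditional gradient method: choose $x^0\in\mathrm{dom}(G)$; for $k=0,1,\dots$ compute a minimizer $p(x^k)$ and the value $\theta(x^k)$; stop if $\theta(x^k)=0$; otherwise compute a step size $\lambda_k\in(0,1]$ and set $x^{k+1}:=x^k+\lambda_k(p(x^k)-x^k)$. Armijo step size: fix $\zeta\in(0,1)$ and $0<\omega_1<\omega_2<1$. Set $\lambda_{k_0}=1$, $\ell=0$. If $F(x^k+\lambda_{k_\ell}[p(x^k)-x^k])\preceq F(x^k)-\zeta\lambda_{k_\ell}|\theta(x^k)|e$, then set $\lambda_k:=\lambda_{k_\ell}$ and finish; otherwise choose any $\lambda_{k_{\ell+1}}\in[\omega_1\lambda_{k_\ell},\omega_2\lambda_{k_\ell}]$, increase $\ell$ by one and repeat the test. *)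

(* Defs.v *)
From mathcomp Require Export all_boot all_order all_algebra.
From mathcomp Require Export all_classical all_reals all_analysis.
Export numFieldNormedType.Exports.

Set Implicit Arguments.
Unset Strict Implicit.
Unset Printing Implicit Defensive.

Import Order.TTheory GRing.Theory Num.Theory.

Local Open Scope classical_set_scope.
Local Open Scope ring_scope.
Local Open Scope ereal_scope.

(* R^n is 'rV[R]_n. Its library norm is the sup norm; only the topology and
   differentiability, which do not depend on the norm, are used. *)

Section smooth.
Context {R : realType} {n : nat}.
Implicit Types (h : 'rV[R]_n -> R) (x u v : 'rV[R]_n).

Definition inner u v : R := (\sum_(i < n) u 0 i * v 0 i)%R.

Definition grad h x : 'rV[R]_n := (\row_i 'D_(delta_mx 0 i) h x)%R.

Definition continuously_differentiable h : Prop :=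
  (forall x, differentiable h x) /\ continuous (grad h).

End smooth.

Section extended_valued.
Context {R : realType} {n : nat}.
Implicit Types (g f : 'rV[R]_n -> \bar R) (x d : 'rV[R]_n).

(* The condition -oo < g x expresses that g takes values in R U {+oo}. *)
Definition eproper g : Prop :=
  (forall x, -oo < g x) /\ (exists x, g x < +oo).

(* The library convention 0 * +oo = 0 makes the cases t = 0 and t = 1
   trivial. *)
Definition econvex g : Prop :=
  forall (x y : 'rV[R]_n) (t : R), (0 <= t <= 1)%R ->
    g (t *: x + (1 - t) *: y)%R <= t%:E * g x + (1 - t)%:E * g y.

(* For f = g + h with g proper convex and h differentiable, this limit exists
   in \bar R (possibly infinite) at each x with g x < +oo. *)
Definition dirderiv f x d : \bar R :=
  lim ((f (x + a *: d)%R - f x) * (a^-1)%:E @[a --> (0 : R)^'+]).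

End extended_valued.

Section multiobjective.
Context {R : realType} {n m : nat}.
Variables (g : 'I_m -> 'rV[R]_n -> \bar R) (h : 'I_m -> 'rV[R]_n -> R).
Implicit Types (x u d p : 'rV[R]_n).

Definition domG : set 'rV[R]_n := [set x | forall j, g j x < +oo].

Definition F (x : 'rV[R]_n) (j : 'I_m) : \bar R := g j x + (h j x)%:E.

Definition vle (u v : 'I_m -> \bar R) : Prop := forall j, u j <= v j.

(* The value -oo is the neutral element of maxe; for 0 < m it does not
   contribute to the maximum. *)
Definition pareto_critical x : Prop :=
  domG x /\
  forall d, 0 <= \big[maxe/-oo]_(j < m) dirderiv (F ^~ j) x d.

Definition gap x u : \bar R :=
  \big[maxe/-oo]_(j < m)
    (g j u - g j x + (inner (grad (h j) x) (u - x)%R)%:E).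

Definition theta x : \bar R := ereal_inf (range (gap x)).

Definition gap_minimizer x u : Prop := domG u /\ gap x u = theta x.

(* An infinite run: the stopping test theta (x k) = 0 never succeeds. *)
Definition gcg_sequence (x p : nat -> 'rV[R]_n) (lambda : nat -> R) : Prop :=
  domG (x 0%N) /\
  forall k, [/\ gap_minimizer (x k) (p k),
    theta (x k) <> 0,
    (0 < lambda k <= 1)%R &
    x k.+1 = (x k + lambda k *: (p k - x k))%R].

Definition armijo_test (zeta : R) x p (t : R) : Prop :=
  vle (F (x + t *: (p - x))%R)
      (fun j => F x j - (zeta * t)%:E * `|theta x|).

(* t l is the l-th trial step size, and the search stops at the first l, here
   L, for which the test succeeds. *)
Definition armijo_step (zeta omega1 omega2 : R) x p (lambda : R) : Prop :=
  exists (t : nat -> R) (L : nat),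
    [/\ t 0%N = 1%R,
      forall l, (l < L)%N -> ~ armijo_test zeta x p (t l) /\
        (omega1 * t l <= t l.+1 <= omega2 * t l)%R,
      armijo_test zeta x p (t L) &
      lambda = t L].

End multiobjective.

(* Main.v *)
Require Import Defs.
From mathcomp Require Import ring lra.

(** The proof shows that theta xbar >= 0 at a limit point xbar, and that this
    inequality already forces Pareto criticality.

    Criticality from theta (pareto_critical_theta_ge0).  The difference
    quotients of a convex g j decrease as the step shrinks, so the directional
    derivative of g j + h j exists and is the sum of the two separate limits.
    If all these derivatives were negative in a direction d, every term of
    gap xbar (xbar + a d) would be negative for small a > 0, whence
    theta xbar < 0.

    Nonnegativity of theta (gcg_theta_cluster_ge0).  Suppose
    gap xbar u < - d < 0 for some u.  For fixed u, each term of gap y u is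
    upper semicontinuous in y, since g j y enters with a minus sign and is
    lower semicontinuous; hence theta y <= - d for all feasible y near xbar
    (gap_lt_near).

    Near such points the line search cannot shrink the step too far.  The
    gradients being continuous, h j lies below its linearization up to an error
    e |v|, uniformly in the base point near xbar (first_order_bound); together
    with the convexity of g j and the boundedness of the domain this makes every
    trial step below a fixed threshold pass the Armijo test
    (armijo_test_small).  A step size is at least omega1 times the last
    rejected trial, so it is bounded below by some c > 0
    (armijo_step_lbound).

    So the step from each of the infinitely many iterates near xbar decreases
    every objective by at least zeta c d.  But the values of an objective along
    the run are nonincreasing (gcg_nonincreasing) and bounded below, by lower
    semicontinuity at xbar (gcg_has_lbound); they converge, and their
    decrements tend to 0, a contradiction. *)

Set Implicit Arguments.
Unset Strict Implicit.
Unset Printing Implicit Defensive.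

Import Order.TTheory GRing.Theory Num.Theory.

Local Open Scope classical_set_scope.
Local Open Scope ring_scope.

(** * Gradients and first-order bounds *)

Section smooth.
Context {R : realType} {n : nat}.
Implicit Types (h : 'rV[R]_n -> R) (x u v y : 'rV[R]_n).

Lemma innerBl u v y : inner (u - v) y = inner u y - inner v y.
Proof.
by rewrite /inner -sumrB; apply: eq_bigr => i _; rewrite !mxE mulrBl.
Qed.

Lemma innerZr (a : R) u v : inner u (a *: v) = a * inner u v.
Proof.
by rewrite /inner mulr_sumr; apply: eq_bigr => i _; rewrite mxE mulrCA.
Qed.

Lemma coord_le_norm u i : `|u 0 i| <= `|u|.
Proof.
rewrite [`|u|]mx_normrE.
exact: (le_bigmax 0 (fun ij : 'I_1 * 'I_n => `|u ij.1 ij.2|) (0, i)).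
Qed.

(** The factor n is the price of using the sup norm on both sides. *)
Lemma normr_inner_le u v : `|inner u v| <= n%:R * `|u| * `|v|.
Proof.
apply: (le_trans (ler_norm_sum _ _ _)).
have -> : n%:R * `|u| * `|v| = \sum_(i < n) `|u| * `|v|.
  by rewrite sumr_const card_ord -mulrA mulr_natl.
apply: ler_sum => i _; rewrite normrM.
by apply: ler_pM; rewrite // coord_le_norm.
Qed.

Lemma cvg_inner {T : Type} {F : set_system T} {FF : Filter F}
    (f g : T -> 'rV[R]_n) u v :
  f t @[t --> F] --> u -> g t @[t --> F] --> v ->
  inner (f t) (g t) @[t --> F] --> inner u v.
Proof.
move=> fu gv; rewrite /inner.
apply: cvg_big => [|i _]; first exact: add_continuous.
apply: cvgM.
  exact: (cvg_comp _ _ fu (@coord_continuous _ _ _ 0 i u)).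
exact: (cvg_comp _ _ gv (@coord_continuous _ _ _ 0 i v)).
Qed.

Lemma derive_inner_grad h x v :
  differentiable h x -> 'D_v h x = inner (grad h x) v.
Proof.
move=> dh; rewrite deriveE// {1}(row_sum_delta v) linear_sum /inner.
by apply: eq_bigr => i _; rewrite linearZ /= mulrC mxE deriveE.
Qed.

(** Restricting to a line turns the mean value theorem for real functions into
    the one for functions on R^n. *)
Lemma is_derive_line h x v (s : R) : differentiable h (x + s *: v) ->
  is_derive s 1 (fun t => h (x + t *: v)) (inner (grad h (x + s *: v)) v).
Proof.
move=> dh; rewrite -derive_inner_grad//.
have E : (fun t : R => t^-1 *: (h (x + (t *: 1 + s) *: v) - h (x + s *: v))) =
         (fun t : R => t^-1 *: (h (t *: v + (x + s *: v)) - h (x + s *: v))).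
  apply/funext => t; congr (_ *: (h _ - _)).
  by rewrite scalerDl addrCA /GRing.scale /= mulr1.
have dv : derivable h (x + s *: v) v by exact: diff_derivable.
by apply: DeriveDef; rewrite /derivable /derive /= E.
Qed.

Lemma mean_value_line h y v (t : R) :
  (forall x, differentiable h x) -> 0 < t ->
  exists2 c, 0 < c < t &
    h (y + t *: v) - h y = t * inner (grad h (y + c *: v)) v.
Proof.
move=> dh t0; pose f s := h (y + s *: v).
have df (s : R) : is_derive s 1 f (inner (grad h (y + s *: v)) v).
  exact: is_derive_line.
have [|c] := @MVT _ f _ 0 t t0 (fun s _ => df s).
  by apply: derivable_within_continuous => s _; case: (df s).
rewrite in_itv /= => cI; rewrite /f scale0r addr0 subr0 mulrC => E.
by exists c.
Qed.

(** The point is uniformity: one radius r serves all base points y near xb.  By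
    the mean value theorem the error is the variation of the gradient between
    y and an intermediate point, both of which lie within 2 r of xb. *)
Lemma first_order_bound h (xb : 'rV[R]_n) (e : R) :
  continuously_differentiable h -> 0 < e ->
  \forall r \near 0^'+, forall y v t, `|xb - y| < r -> 0 < t -> `|t *: v| < r ->
    h (y + t *: v) <= h y + t * (inner (grad h y) v + e * `|v|).
Proof.
move=> [dh ch] e0.
(* Each gradient is within e / (2 (n + 1)) of the gradient at xb, so the two
   differ by at most e / (n + 1), and the inner product costs a factor n. *)
have k0 : 0 < e / (2 * n.+1%:R) by rewrite divr_gt0// mulr_gt0.
have /cvgrPdist_lt/(_ _ k0)/nbhs_normP[r0 /= r0_gt0 rP] := ch xb.
near=> r => y v t yr t0 tv.
have r_lt : r < r0 / 2 by near: r; apply: nbhs_right_lt; rewrite divr_gt0.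
have [c /andP[c0 ct] E] := mean_value_line y v dh t0.
have cv : `|c *: v| < r.
  apply: le_lt_trans tv; rewrite !normrZ ler_wpM2r//.
  by rewrite !gtr0_norm// ltW.
have gy : `|grad h xb - grad h y| < e / (2 * n.+1%:R).
  by apply: rP => /=; apply: (lt_trans yr); lra.
have gc : `|grad h xb - grad h (y + c *: v)| < e / (2 * n.+1%:R).
  apply: rP => /=; rewrite opprD addrA.
  by apply: (le_lt_trans (ler_normB _ _)); lra.
rewrite -lerBlDl E ler_pM2l// -lerBlDl -innerBl.
apply: (le_trans (ler_norm _)); apply: (le_trans (normr_inner_le _ _)).
rewrite ler_wpM2r//.
have gg : `|grad h (y + c *: v) - grad h y| <= e / n.+1%:R.
  rewrite -(subrK (grad h xb) (grad h (y + c *: v))) -addrA.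
  apply: (le_trans (ler_normD _ _)); rewrite [X in X + _]distrC.
  have -> : e / n.+1%:R = e / (2 * n.+1%:R) + e / (2 * n.+1%:R).
    by field; rewrite addrC natr1 pnatr_eq0.
  by rewrite lerD// ltW.
apply: (@le_trans _ _ (n.+1%:R * (e / n.+1%:R))).
  by apply: ler_pM => //; rewrite ler_nat.
by rewrite mulrCA divff ?mulr1// pnatr_eq0.
Unshelve. all: by end_near. Qed.

End smooth.

(** * Directional derivatives of convex functions *)

Section convexity.
Context {R : realType} {n : nat}.
Implicit Types (g : 'rV[R]_n -> \bar R) (x d y : 'rV[R]_n).

Lemma econvex_segment g x d (t : R) : econvex g -> 0 <= t <= 1 ->
  (g (x + t *: d)%R <= t%:E * g (x + d)%R + (1 - t)%:E * g x)%E.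
Proof.
move=> cg /(cg (x + d) x).
suff -> : t *: (x + d) + (1 - t) *: x = x + t *: d by [].
by rewrite scalerDr scalerBl scale1r addrC -addrA addKr.
Qed.

Lemma eproper_fin_num g x : eproper g -> (g x < +oo)%E -> g x \is a fin_num.
Proof. by move=> [gp _] gx; rewrite fin_numElt gp. Qed.

Definition gquot g x d (a : R) : \bar R :=
  ((g (x + a *: d)%R - g x) * (a^-1)%:E)%E.

(** For a <= b the point x + a d lies on the segment from x to x + b d, at the
    fraction a / b of its length. *)
Lemma gquot_nondecreasing g x d (a b : R) :
  eproper g -> econvex g -> (g x < +oo)%E ->
  0 < a -> a <= b -> (gquot g x d a <= gquot g x d b)%E.
Proof.
move=> pg cg /(eproper_fin_num pg)/fineK gx a0 ab.
have b0 : 0 < b by exact: lt_le_trans ab.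
have t01 : 0 <= a / b <= 1.
  by rewrite ler_pdivrMr// mul1r ab andbT ltW// divr_gt0.
have := econvex_segment x (b *: d) cg t01.
rewrite scalerA divfK ?gt_eqF// /gquot -gx.
case: (g (x + b *: d)) (pg.1 (x + b *: d)) => [gb| |]//.
- move=> _; case: (g (x + a *: d)) (pg.1 (x + a *: d)) => [ga| |]// _.
  rewrite -!EFinM -!EFinD !lee_fin => H.
  rewrite ler_pdivrMr//.
  have -> : (gb - fine (g x)) / b * a = a / b * (gb - fine (g x)) by ring.
  move: H; lra.
- by move=> _ _; rewrite addye// gt0_mulye ?leey// lte_fin invr_gt0.
Qed.

Lemma gquot_is_cvg g x d :
  eproper g -> econvex g -> (g x < +oo)%E -> cvg (gquot g x d a @[a --> 0^'+]).
Proof.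
move=> pg cg gx; apply: nondecreasing_at_right_is_cvge.
near=> b => s t; rewrite !in_itv /= => /andP[s0 _] _ st.
exact: gquot_nondecreasing.
Unshelve. all: by end_near. Qed.

Lemma cvg_diff_quotient (h : 'rV[R]_n -> R) x d : differentiable h x ->
  (h (x + a *: d) - h x) / a @[a --> 0^'+] --> inner (grad h x) d.
Proof.
move=> dh; rewrite -derive_inner_grad//.
have dv : derivable h x d by exact: diff_derivable.
suff -> : (fun a : R => (h (x + a *: d) - h x) / a) =
          (fun a : R => a^-1 *: (h (a *: d + x) - h x)).
  exact: cvg_dnbhs_at_right.
by apply/funext => a; rewrite /GRing.scale /= mulrC [a *: d + x]addrC.
Qed.

(** The limit in the definition of dirderiv is a total operator, which says
    nothing unless the quotient converges; here it does, by monotonicity for g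
    and by differentiability for h, and the second limit is finite so that the
    sum is never of the form oo - oo. *)
Lemma dirderiv_addE g (h : 'rV[R]_n -> R) x d :
  eproper g -> econvex g -> (g x < +oo)%E -> differentiable h x ->
  dirderiv (fun y => (g y + (h y)%:E)%E) x d =
  (lim (gquot g x d a @[a --> 0^'+]) + (inner (grad h x) d)%:E)%E.
Proof.
move=> pg cg gx dh; apply: cvg_lim => //.
have C : (gquot g x d a + ((h (x + a *: d)%R - h x) / a)%:E)%E @[a --> 0^'+] -->
    (lim (gquot g x d a @[a --> 0^'+]) + (inner (grad h x) d)%:E)%E.
  apply: cvgeD; first by rewrite fin_num_adde_defl.
    exact: gquot_is_cvg.
  by apply: cvg_EFin; [near=> a | exact: cvg_diff_quotient].
apply: cvg_trans C; apply: near_eq_cvg; near=> a.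
have a0 : 0 < a by [].
have /fineK gxE := eproper_fin_num pg gx.
rewrite /gquot -gxE.
case: (g (x + a *: d)) (pg.1 (x + a *: d)) => [ga| |]// _.
  rewrite -!EFinD; congr EFin.
  by field; rewrite gt_eqF.
by rewrite !addye// gt0_mulye ?lte_fin ?invr_gt0.
Unshelve. all: by end_near. Qed.

End convexity.

(** * The gap function *)

Section gap.
Context {R : realType} {n m : nat}.
Variables (g : 'I_m -> 'rV[R]_n -> \bar R) (h : 'I_m -> 'rV[R]_n -> R).
Implicit Types (x u d p : 'rV[R]_n).
Hypothesis g_proper : forall j, eproper (g j).
Hypothesis g_convex : forall j, econvex (g j).

Lemma gap_ltP x u (c : R) :
  (gap g h x u < c%:E)%E <->
  forall j, (g j u - g j x + (inner (grad (h j) x) (u - x))%:E < c%:E)%E.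
Proof.
split=> [/bigmax_ltP[_ H] j|H]; first exact: H.
by apply/bigmax_ltP; split=> [|j _]; rewrite ?ltNyr.
Qed.

Lemma domG_fineK x j : domG g x -> (fine (g j x))%:E = g j x.
Proof. by move=> dx; rewrite fineK// eproper_fin_num. Qed.

Lemma domG_segment x p (t : R) : domG g x -> domG g p -> 0 <= t <= 1 ->
  domG g (x + t *: (p - x)).
Proof.
move=> dx dp t01 j.
apply: le_lt_trans (econvex_segment x (p - x) (g_convex j) t01) _.
by rewrite subrKC -(domG_fineK j dx) -(domG_fineK j dp) -!EFinM -EFinD ltry.
Qed.

(** A direction along which all objectives decrease strictly yields, for a
    small step, a point at which the gap is negative. *)
Lemma pareto_critical_theta_ge0 x :
  (forall j, differentiable (h j) x) ->
  domG g x -> (0 <= theta g h x)%E -> pareto_critical g h x.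
Proof.
move=> dh dx th0; split => // d; rewrite leNgt; apply/negP => /bigmax_ltP[_ dd].
have near_neg j : \forall a \near 0^'+,
    (gquot (g j) x d a + (inner (grad (h j) x) d)%:E < 0)%E.
  have := dd j isT; rewrite /F dirderiv_addE// => Lneg.
  have C : (gquot (g j) x d a + (inner (grad (h j) x) d)%:E)%E @[a --> 0^'+] -->
      (lim (gquot (g j) x d a @[a --> 0^'+]) + (inner (grad (h j) x) d)%:E)%E.
    apply: cvgeD; first by rewrite fin_num_adde_defl.
      exact: gquot_is_cvg.
    exact: cvg_cst.
  exact: (C _ (open_ereal_lt' Lneg)).
have [a [a0 aneg]] : exists a : R, 0 < a /\ forall j,
    (gquot (g j) x d a + (inner (grad (h j) x) d)%:E < 0)%E.
  near (0 : R)^'+ => a; exists a; split=> //.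
  by near: a; exact: filter_forall.
suff : (gap g h x (x + a *: d)%R < 0%:E)%E.
  apply/negP; rewrite -leNgt; apply: (le_trans th0).
  by apply: ereal_inf_lbound; exists (x + a *: d).
apply/gap_ltP => j.
have -> : x + a *: d - x = a *: d by rewrite addrAC subrr add0r.
rewrite innerZr.
have := aneg j; rewrite /gquot -(domG_fineK j dx).
case: (g j (x + a *: d)) ((g_proper j).1 (x + a *: d)) => [ga| |]// _.
  rewrite -!EFinB -!EFinM -!EFinD !lte_fin => neg.
  have -> : ga - fine (g j x) + a * inner (grad (h j) x) d =
     a * ((ga - fine (g j x)) / a + inner (grad (h j) x) d).
    by field; rewrite gt_eqF.
  by rewrite pmulr_rlt0.
by rewrite addye// gt0_mulye ?lte_fin ?invr_gt0.
Unshelve. all: by end_near. Qed.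

(** Upper semicontinuity of the gap in its first argument: g j x enters with a
    minus sign, so lower semicontinuity is the right one-sided hypothesis. *)
Lemma gap_lt_near x u (c : R) :
  (forall j, continuous (grad (h j))) -> (forall j, lower_semicontinuous (g j)) ->
  domG g x -> (gap g h x u < c%:E)%E ->
  \forall y \near x, domG g y -> (gap g h y u < c%:E)%E.
Proof.
move=> ch lg dx /gap_ltP gc.
suff H j : \forall y \near x, domG g y ->
    (g j u - g j y + (inner (grad (h j) y) (u - y))%:E < c%:E)%E.
  near=> y => dy; apply/gap_ltP => j; move: dy.
  by move: j; near: y; exact: filter_forall.
have := gc j; rewrite -(domG_fineK j dx).
case gu : (g j u) ((g_proper j).1 u) => [v| |]// _.
rewrite -EFinB -EFinD lte_fin => vc.
set i := inner _ _ in vc.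
pose e := (c - (v - fine (g j x) + i)) / 2.
have e0 : 0 < e by rewrite divr_gt0// subr_gt0.
have [|V Vx gV] := lg j x (fine (g j x) - e).
  by rewrite -[ltRHS](domG_fineK j dx) lte_fin; lra.
have ci : inner (grad (h j) y) (u - y) @[y --> x] --> i.
  apply: (@cvg_inner _ _ _ (nbhs x)); first exact: ch.
  by apply: cvgB; [exact: cvg_cst | exact: cvg_id].
have iN : \forall y \near x, inner (grad (h j) y) (u - y) < i + e.
  by apply: cvgr_lt ci _ _; rewrite ltrDl.
near=> y => dy.
have gy : ((fine (g j x) - e)%:E < g j y)%E by apply: gV; near: y.
have iy : inner (grad (h j) y) (u - y) < i + e by near: y.
move: gy; rewrite -(domG_fineK j dy) lte_fin -EFinB -EFinD lte_fin => gy.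
have -> : c = v - (fine (g j x) - e) + (i + e) by rewrite /e; field.
by rewrite ltrD// ltrD2l ltrN2.
Unshelve. all: by end_near. Qed.

End gap.

(** * The Armijo line search *)

Section step.
Context {R : realType} {n m : nat}.
Variables (g : 'I_m -> 'rV[R]_n -> \bar R) (h : 'I_m -> 'rV[R]_n -> R).
Implicit Types (x y u v p : 'rV[R]_n).
Hypothesis m_gt0 : (0 < m)%N.
Hypothesis g_proper : forall j, eproper (g j).
Hypothesis g_convex : forall j, econvex (g j).

(** The values of the objectives on the domain, where they are finite; off the
    domain fine collapses the infinite values of g j to 0. *)
Definition realF j x : R := fine (g j x) + h j x.

Lemma F_realF x j : domG g x -> F g h x j = (realF j x)%:E.
Proof. by move=> dx; rewrite /F -(domG_fineK g_proper j dx). Qed.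

Lemma theta_le_gap x u : (theta g h x <= gap g h x u)%E.
Proof. by apply: ereal_inf_lbound; exists u. Qed.

Lemma theta_le0 x : domG g x -> (theta g h x <= 0)%E.
Proof.
move=> dx; apply: le_trans (theta_le_gap x x) _.
apply/bigmax_leP; split=> // j _.
rewrite -(domG_fineK g_proper j dx) -EFinB -EFinD subrr subrr add0r.
by rewrite -[X in inner _ X](scale0r 0) innerZr mul0r.
Qed.

(** Feasibility of x and p makes every term of the gap finite, and a maximum over
    a nonempty index set is then finite too. *)
Lemma gap_minimizerP x p : domG g x -> gap_minimizer g h x p ->
  exists2 th : R, theta g h x = th%:E &
  forall j, fine (g j p) - fine (g j x) + inner (grad (h j) x) (p - x) <= th.
Proof.
move=> dx [dp gE].
have le_theta j : ((fine (g j p) - fine (g j x) +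
    inner (grad (h j) x) (p - x))%:E <= theta g h x)%E.
  rewrite -gE /gap EFinD EFinB !domG_fineK//.
  by apply: (bigmax_sup j).
have : theta g h x \is a fin_num.
  rewrite fin_numElt (lt_le_trans _ (le_theta (Ordinal m_gt0))) ?ltNyr//=.
  exact: le_lt_trans (theta_le0 dx) (ltry _).
move=> /fineK thE; exists (fine (theta g h x)) => // j.
by rewrite -lee_fin thE.
Qed.

Lemma armijo_testP (zeta th t : R) x p :
  domG g x -> domG g p -> theta g h x = th%:E -> 0 <= t <= 1 ->
  armijo_test g h zeta x p t <->
  forall j, realF j (x + t *: (p - x)) <= realF j x + zeta * t * th.
Proof.
move=> dx dp thE t01.
have th0 : th <= 0 by rewrite -lee_fin -thE theta_le0.
have dt := domG_segment g_proper g_convex dx dp t01.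
split=> [H j|H j].
  have := H j; rewrite !F_realF// thE abse_EFin -EFinM -EFinB lee_fin.
  by rewrite ler0_norm// mulrN opprK.
rewrite !F_realF// thE abse_EFin -EFinM -EFinB lee_fin.
by rewrite ler0_norm// mulrN opprK.
Qed.

(** By convexity of g j and the first-order bound on h j, a step t raises each
    objective by at most t (th + e D).  The condition on e D says that this is
    at most zeta t th. *)
Lemma armijo_test_small (zeta r e D th t : R) x p :
  domG g x -> gap_minimizer g h x p -> theta g h x = th%:E ->
  (forall j v s, 0 < s -> `|s *: v| < r ->
    h j (x + s *: v) <= h j x + s * (inner (grad (h j) x) v + e * `|v|)) ->
  `|p - x| <= D -> 0 <= e -> e * D <= (zeta - 1) * th ->
  0 < t <= 1 -> t * D < r -> armijo_test g h zeta x p t.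
Proof.
move=> dx mp thE hb pD e0 eD /andP[t0 t1] tD.
have dp := mp.1.
have t01 : 0 <= t <= 1 by rewrite t1 ltW.
apply/(armijo_testP _ dx dp thE t01) => j.
have [th' thE' /(_ j) gap_le] := gap_minimizerP dx mp.
move: thE'; rewrite thE => -[?]; subst th'.
have dt := domG_segment g_proper g_convex dx dp t01.
have gc := econvex_segment x (p - x) (g_convex j) t01.
move: gc; rewrite subrKC -(domG_fineK g_proper j dx) -(domG_fineK g_proper j dp).
rewrite -(domG_fineK g_proper j dt) -!EFinM -EFinD lee_fin => gc.
have hj : h j (x + t *: (p - x)) <=
    h j x + t * (inner (grad (h j) x) (p - x) + e * `|p - x|).
  apply: hb => //; rewrite normrZ gtr0_norm//.
  by apply: le_lt_trans tD; rewrite ler_wpM2l// ltW.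
have ep : e * `|p - x| <= (zeta - 1) * th.
  by apply: le_trans eD; rewrite ler_wpM2l.
have tP : t * (fine (g j p) - fine (g j x) +
    inner (grad (h j) x) (p - x) + e * `|p - x|) <= t * (zeta * th).
  by rewrite ler_pM2l//; lra.
rewrite /realF; apply: (le_trans (lerD gc hj)).
rewrite -subr_ge0; rewrite -subr_ge0 in tP; apply: (le_trans tP).
by rewrite le_eqVlt; apply/orP; left; apply/eqP; ring.
Qed.

(** Either the unit step is accepted, or the last rejected trial t satisfies
    t D >= r by armijo_test_small, and the accepted step is at least
    omega1 t. *)
Lemma armijo_step_lbound (zeta omega1 omega2 r e D th lambda : R) x p :
  0 < omega1 -> omega2 < 1 ->
  domG g x -> gap_minimizer g h x p -> theta g h x = th%:E ->
  (forall j v s, 0 < s -> `|s *: v| < r ->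
    h j (x + s *: v) <= h j x + s * (inner (grad (h j) x) v + e * `|v|)) ->
  0 < D -> `|p - x| <= D -> 0 <= e -> e * D <= (zeta - 1) * th ->
  armijo_step g h zeta omega1 omega2 x p lambda ->
  Num.min 1 (omega1 * (r / D)) <= lambda.
Proof.
move=> w1 w2 dx mp thE hb D0 pD e0 eD [t [L [t0 tS tL ->]]].
rewrite ge_min.
have t01 l : (l <= L)%N -> 0 < t l <= 1.
  elim: l => [_|l IH lL]; first by rewrite t0 ltr01 lexx.
  have /andP[l0 l1] := IH (ltnW lL).
  have [_ /andP[lo hi]] := tS l lL.
  rewrite (lt_le_trans _ lo) ?mulr_gt0//=.
  apply: (le_trans hi); apply: (le_trans _ l1).
  by rewrite ler_piMl// ltW.
case: L tS tL t01 => [|L] tS tL t01; first by rewrite t0 lexx.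
have [fail /andP[lo _]] := tS L (ltnSn L).
apply/orP; right; apply: le_trans lo; rewrite ler_pM2l// ler_pdivrMr//.
rewrite leNgt; apply/negP => tD; apply: fail.
exact: (armijo_test_small dx mp thE hb pD e0 eD (t01 L (leqnSn L))).
Qed.

End step.

(** * Convergence of the method *)

Lemma cluster_seq_frequently {T : topologicalType} (x : nat -> T) (l : T)
    (B : set T) (N : nat) :
  cluster (x @ \oo) l -> nbhs l B -> exists2 k, (N <= k)%N & B (x k).
Proof.
move=> cl Bl; have [|_ [[k Nk <-] Bk]] := cl (x @` [set k | (N <= k)%N]) B _ Bl.
  by exists N => // k Nk; exists k.
by exists k.
Qed.

Lemma decrements_cvg0 {R : realType} (u : nat -> R) :
  nonincreasing_seq u -> has_lbound (range u) ->
  u k - u k.+1 @[k --> \oo] --> 0.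
Proof.
move=> du lu; have cu := nonincreasing_is_cvgn du lu.
rewrite -(subrr (limn u)); apply: cvgB => //.
by rewrite -cvg_shiftS in cu.
Qed.

Section run.
Context {R : realType} {n m : nat}.
Variables (g : 'I_m -> 'rV[R]_n -> \bar R) (h : 'I_m -> 'rV[R]_n -> R).
Hypothesis m_gt0 : (0 < m)%N.
Hypothesis g_proper : forall j, eproper (g j).
Hypothesis g_convex : forall j, econvex (g j).
Variables (zeta omega1 omega2 : R) (x p : nat -> 'rV[R]_n) (lambda : nat -> R).
Hypothesis zeta01 : 0 < zeta < 1.
Hypothesis x_gcg : gcg_sequence g h x p lambda.
Hypothesis x_armijo : forall k,
  armijo_step g h zeta omega1 omega2 (x k) (p k) (lambda k).

Lemma gcg_domG k : domG g (x k).
Proof.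
elim: k => [|k IH]; first exact: x_gcg.1.
have [[dp _] _ /andP[l0 l1] ->] := x_gcg.2 k.
by apply: domG_segment => //; rewrite l1 ltW.
Qed.

Lemma gcg_theta k : exists2 th : R, theta g h (x k) = th%:E & th < 0.
Proof.
have [mp th0 _ _] := x_gcg.2 k; have dx := gcg_domG k.
have [th thE _] := gap_minimizerP m_gt0 g_proper dx mp.
exists th => //; rewrite -lte_fin -thE lt_neqAle theta_le0// andbT.
exact/eqP.
Qed.

Lemma gcg_decrease k j (th : R) : theta g h (x k) = th%:E ->
  realF g h j (x k.+1) <= realF g h j (x k) + zeta * lambda k * th.
Proof.
move=> thE; have [[dp _] _ /andP[l0 l1] ->] := x_gcg.2 k.
have [t [L [_ _ tL lE]]] := x_armijo k; rewrite -lE in tL.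
have l01 : 0 <= lambda k <= 1 by rewrite l1 ltW.
by have /(armijo_testP g_proper g_convex _ (gcg_domG k) dp thE l01)/(_ j) := tL.
Qed.

Lemma gcg_nonincreasing j : nonincreasing_seq (fun k => realF g h j (x k)).
Proof.
apply/nonincreasing_seqP => k; have [th thE th0] := gcg_theta k.
apply: le_trans (gcg_decrease j thE) _.
have [_ _ /andP[l0 _] _] := x_gcg.2 k.
by rewrite gerDl nmulr_lle0// mulr_ge0// ltW//; case/andP: zeta01.
Qed.

(** Lower semicontinuity at xbar bounds the objective below at the infinitely
    many iterates close to xbar; monotonicity extends the bound to all of
    them. *)
Lemma gcg_has_lbound j xbar : lower_semicontinuous (g j) ->
  {for xbar, continuous (h j)} -> cluster (x @ \oo) xbar -> domG g xbar ->
  has_lbound (range (fun k => realF g h j (x k))).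
Proof.
move=> lg ch cl dxb.
have [|V Vx gV] := lg xbar (fine (g j xbar) - 1).
  by rewrite -[ltRHS](domG_fineK g_proper j dxb) lte_fin; lra.
have Hn : \forall y \near xbar, h j xbar - 1 < h j y.
  by apply: (cvgr_gt _ ch); lra.
exists (fine (g j xbar) - 1 + (h j xbar - 1)) => _ [k _ <-].
have [i ki [/gV Vi hi]] := cluster_seq_frequently k cl (filterI Vx Hn).
apply: le_trans (gcg_nonincreasing j ki); rewrite lerD ?(ltW hi)//.
by move: Vi; rewrite -(domG_fineK g_proper j (gcg_domG i)) lte_fin => /ltW.
Qed.

(** If theta were negative at xbar, it would stay below - d at nearby iterates,
    their step sizes would stay above some c > 0, and each would decrease the
    objectives by zeta c d, which a convergent sequence allows only finitely
    often. *)
Lemma gcg_theta_cluster_ge0 xbar :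
  (forall j, continuously_differentiable (h j)) ->
  (forall j, lower_semicontinuous (g j)) ->
  bounded_set (domG g) -> 0 < omega1 -> omega2 < 1 ->
  cluster (x @ \oo) xbar -> domG g xbar -> (0 <= theta g h xbar)%E.
Proof.
move=> hC lg [M [_ domM]] w1 w2 cl dxb.
have /andP[z0 z1] := zeta01.
rewrite leNgt; apply/negP => /ereal_inf_lt[_ [u _ <-] gap_neg].
have [d d0 gap_d] : exists2 d : R, 0 < d & (gap g h xbar u < (- d)%:E)%E.
  case E : (gap g h xbar u) gap_neg => [a| |]//.
    by rewrite lte_fin => a0; exists (- (a / 2)); rewrite ?lte_fin; lra.
  by move=> _; exists 1; rewrite ?ltr01 ?ltNyr.
(* D bounds the diameter of the domain. *)
pose D := 2 * (`|M| + 1).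
have D0 : 0 < D by rewrite mulr_gt0// ltr_wpDl.
have pD k : `|p k - x k| <= D.
  have bd y : domG g y -> `|y| <= `|M| + 1.
    by apply: domM; rewrite (le_lt_trans (ler_norm M))// ltrDl.
  have [[dp _] _ _ _] := x_gcg.2 k.
  apply: (le_trans (ler_normB _ _)).
  by rewrite /D mulr_natl mulr2n lerD// bd//; exact: gcg_domG.
(* The largest tolerance for which e D <= (zeta - 1) th whenever th <= - d. *)
pose e := (1 - zeta) * d / D.
have e0 : 0 < e by rewrite divr_gt0// mulr_gt0// subr_gt0.
have [r [r0 hr]] : exists r, 0 < r /\ forall j y v t, `|xbar - y| < r -> 0 < t ->
    `|t *: v| < r ->
    h j (y + t *: v) <= h j y + t * (inner (grad (h j) y) v + e * `|v|).
  near (0 : R)^'+ => r; exists r; split => //.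
  near: r; apply: filter_forall => j; exact: first_order_bound.
pose c := Num.min 1 (omega1 * (r / D)).
have c0 : 0 < c by rewrite lt_min ltr01 mulr_gt0// divr_gt0.
have j : 'I_m by exact: Ordinal m_gt0.
have ch : {for xbar, continuous (h j)}.
  by apply: differentiable_continuous; case: (hC j).
have zcd0 : 0 < zeta * c * d by rewrite !mulr_gt0.
have /cvgrPdist_lt/(_ _ zcd0)[N _ small] :=
  decrements_cvg0 (gcg_nonincreasing j) (gcg_has_lbound (lg j) ch cl dxb).
have gap_near := gap_lt_near g_proper (fun j => (hC j).2) lg dxb gap_d.
have r_near : \forall y \near xbar, `|xbar - y| < r.
  by apply/nbhs_normP; exists r.
have [k Nk [/(_ (gcg_domG k)) gap_k xk]] :=
  cluster_seq_frequently N cl (filterI gap_near r_near).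
have [th thE th0] := gcg_theta k.
have thd : th <= - d.
  by rewrite -lee_fin -thE (le_trans (theta_le_gap _ _ _ u))// ltW.
have [mp _ /andP[l0 _] _] := x_gcg.2 k.
have lc : c <= lambda k.
  apply: (armijo_step_lbound m_gt0 g_proper g_convex w1 w2 (gcg_domG k) mp thE
    _ D0 (pD k) (ltW e0) _ (x_armijo k)).
  - by move=> i v s s0 sv; exact: hr.
  - have -> : (zeta - 1) * th = (1 - zeta) * - th by ring.
    rewrite divfK ?gt_eqF//.
    by apply: ler_wpM2l; [rewrite subr_ge0 ltW | rewrite lerNr].
have := small k Nk; rewrite /= sub0r normrN; apply/negP; rewrite -leNgt.
apply: le_trans (ler_norm _).
have dec := gcg_decrease j thE.
suff : zeta * c * d <= zeta * lambda k * - th by move: dec; lra.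
rewrite -!mulrA ler_pM2l//.
by apply: ler_pM (ltW c0) (ltW d0) lc _; rewrite lerNr.
Unshelve. all: by end_near. Qed.

End run.

Theorem theorem8 (R : realType) (n m : nat) (hm : (0 < m)%N)
  (g : 'I_m -> 'rV[R]_n -> \bar R) (h : 'I_m -> 'rV[R]_n -> R)
  (h_C1 : forall j, continuously_differentiable (h j))
  (g_proper : forall j, eproper (g j))
  (g_convex : forall j, econvex (g j))
  (g_lsc : forall j, lower_semicontinuous (g j))
  (dom_convex : convex_set (domG g))
  (dom_compact : compact (domG g))
  (zeta omega1 omega2 : R)
  (hzeta : 0 < zeta < 1)
  (homega : [/\ 0 < omega1, omega1 < omega2 & omega2 < 1])
  (x p : nat -> 'rV[R]_n) (lambda : nat -> R)
  (x_gcg : gcg_sequence g h x p lambda)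
  (lambda_armijo : forall k,
     armijo_step g h zeta omega1 omega2 (x k) (p k) (lambda k))
  (xbar : 'rV[R]_n) (hxbar : cluster (x @ \oo) xbar) :
  pareto_critical g h xbar.
Proof.
have [w1 _ w2] := homega.
have dxb : domG g xbar.
  apply: (compact_closed (@norm_hausdorff _ _) dom_compact) => B Bx.
  have [k _ Bk] := cluster_seq_frequently 0 hxbar Bx.
  by exists (x k); split=> //; exact: (gcg_domG g_proper g_convex x_gcg).
apply: pareto_critical_theta_ge0 => //; first by move=> j; case: (h_C1 j).
apply: (gcg_theta_cluster_ge0 hm g_proper g_convex hzeta x_gcg
  lambda_armijo) => //.
exact: compact_bounded.
Qed.
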